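(* Let $n \geq 1$ and $b \geq 2$ be integers and let $k \in \{0,1,\dots,b-1\}$. Put $\rho(b) := \frac{b \sin(\pi/b)}{\pi}$. Then $\rho(b) \in (0,1)$ and $$\left| \frac{1}{n!}\sum_{r \equiv k \ (\mathrm{mod}\ b)} A(n,r) - \frac{1}{b} \right| \leq \frac{b-1}{b}\, \rho(b)^{n-1}.$$ Moreover, $$\rho(b)^{n-1} \leq \exp\left(-\frac{(n-1)\pi^2}{8b^2}\right).$$
   Context: A permutation $\pi$ of $\{1,\dots,n\}$ has a descent at position $i$, where $1 \leq i \leq n-1$, if $\pi(i) > \pi(i+1)$. The Eulerian number $A(n,r)$ is the number of permutations of $\{1,\dots,n\}$ with exactly $r$ descents (so $A(n,r)=0$ unless $0\le r\le n-1$, and the sum over $r$ is finite). *)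

(* Defs.v *)
From mathcomp Require Import all_boot all_order all_algebra all_fingroup.
From mathcomp Require Import reals trigo.

Set Implicit Arguments.
Unset Strict Implicit.
Unset Printing Implicit Defensive.

Import Order.TTheory GRing.Theory Num.Theory.

(* Values and positions are numbered from 0, so the positions of descents
   are the i : 'I_n with i.+1 < n; the witness j below is i + 1, hence no
   descent is recorded at the last position. *)
Definition is_descent (n : nat) (s : 'S_n) (i : 'I_n) : bool :=
  [exists j : 'I_n, (j == i.+1 :> nat) && (s j < s i)].

Definition descents (n : nat) (s : 'S_n) : nat := #|[set i | is_descent s i]|.

Definition eulerian (n r : nat) : nat :=
  #|[set s : 'S_n | descents s == r]|.

Local Open Scope ring_scope.

Definition rho (R : realType) (b : nat) : R :=
  b%:R * sin (pi / b%:R) / pi.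

(* Main.v *)
Require Import Defs.
From mathcomp Require Import boolp functions classical_sets.
From mathcomp Require Import all_boot all_order all_algebra all_fingroup.
From mathcomp Require Import reals topology normedtype derive realfun.
From mathcomp Require Import sequences exp trigo.
From mathcomp Require Import ring lra.

(** Let A_n(z) be the sum of z^(des s) over all permutations s of n letters.
    Fourier inversion on Z/b (sum_eulerian_mod) writes b times the number of
    permutations with des s = k modulo b as a sum over 0 <= j < b of real parts
    of A_n(exp(2 i t)), up to a phase, at t = pi j / b. The term j = 0 is n!, and
    gives the 1/b of the statement; what has to be shown is that each of the
    b - 1 other terms is at most n! rho(b)^(n - 1) in absolute value.

    The point is that A_n(exp(2 i t)) is, up to a unimodular factor and a power
    of sin t, the n-th derivative of the cotangent. Inserting the largest letter
    into a permutation gives a first order differential recurrence for the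
    centred wave W_n(t), the real part of exp(i (phi - (n - 1) t)) A_n(exp(2 i t))
    (descent_wave_rec), and this recurrence says that W_n / sin^(n+1) is minus
    the derivative of W_(n-1) / sin^n (is_derive_cot_wave).

    From the expansion of the cotangent as the sum of 1 / (t + m pi) one would
    get W_(n+1)(t) / (n + 1)! = cos phi * sum_m (sin t / (t + m pi))^(n + 2). Since
    the squares of the numbers sin t / (t + m pi) sum to 1, this is at most
    (sin a / a)^n, where a is the distance from t to the multiples of pi. The
    proof below replaces this series by the duplication formula of the cotangent
    (cot_wave_halving). Iterating it p times expresses the value at t by values
    at 2^p points, where the wave is bounded trivially by n!; this yields the
    same estimate with 2^p sin(a / 2^p) in the place of a (cot_wave_le_halving),
    and p tends to infinity (cot_wave_le). As sin x / x decreases on ]0, pi]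
    (sinc_nincr) and pi j / b is at distance at least pi / b from 0 and pi, the
    factor sin a / a is at most rho(b).

    Finally, with x = pi / b, rho(b) = sin x / x <= cos (x / 2) <= exp(- x^2 / 8),
    which gives the last inequality as well as rho(b) < 1. *)

Set Implicit Arguments.
Unset Strict Implicit.
Unset Printing Implicit Defensive.
Import Order.TTheory GRing.Theory Num.Theory.
Import numFieldNormedType.Exports.
Local Open Scope ring_scope.

(** * Inserting the largest letter *)

Lemma lift_perm_max_inj n :
  injective (fun p : 'I_n.+1 * 'S_n => lift_perm p.1 ord_max p.2).
Proof.
move=> [i s] [j t] /= eq_st.
have ij : i = j.
  by apply: (@perm_inj _ (lift_perm j ord_max t));
     rewrite lift_perm_id -eq_st lift_perm_id.
case: _ / ij in eq_st *; congr pair; apply/permP => k.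
by apply: (@lift_inj _ ord_max); rewrite -!(lift_perm_lift i) eq_st.
Qed.

(** Every permutation of n.+1 letters arises exactly once by inserting the
    largest letter at some position i of the word of a permutation of n
    letters. *)
Lemma big_lift_perm_max (V : nmodType) n (F : 'S_n.+1 -> V) :
  \sum_t F t = \sum_(s : 'S_n) \sum_i F (lift_perm i ord_max s).
Proof.
rewrite exchange_big pair_bigA /=.
apply: (reindex (fun p : 'I_n.+1 * 'S_n => lift_perm p.1 ord_max p.2)).
apply: onW_bij; apply: inj_card_bij; first exact: lift_perm_max_inj.
by rewrite card_prod !card_Sn card_ord factS.
Qed.

Lemma is_descentP n (s : 'S_n) (i j : 'I_n) :
  j = i.+1 :> nat -> is_descent s i = (s j < s i)%N.
Proof.
move=> ji; apply/existsP/idP => [[l /andP[/eqP li]]|lt_s].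
  by rewrite (_ : l = j) //; apply: val_inj; rewrite /= li.
by exists j; rewrite ji eqxx.
Qed.

Lemma is_descent_ltn n (s : 'S_n) i : is_descent s i -> (i.+1 < n)%N.
Proof. by case/existsP => j /andP[/eqP <-]. Qed.

Lemma descentsE n (s : 'S_n) : descents s = (\sum_i is_descent s i)%N.
Proof. by rewrite /descents cardsE -sum1_card big_mkcond. Qed.

Lemma descents_ltn n (s : 'S_n.+1) : (descents s < n.+1)%N.
Proof.
rewrite ltnS (leq_trans (n := #|[set~ @ord_max n]|)) //; last first.
  by rewrite cardsC1 card_ord.
apply: subset_leq_card; apply/subsetP => i.
rewrite !inE => /is_descent_ltn lt_i.
by apply: contraTneq lt_i => ->; rewrite ltnn.
Qed.

(** Inserting the largest letter at position i breaks the old adjacency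
    between positions i - 1 and i, so a descent there is lost (the step up to
    the largest letter is an ascent); all other old descents survive. *)
Lemma is_descent_lift n (s : 'S_n) (i : 'I_n.+1) (k : 'I_n) :
  is_descent (lift_perm i ord_max s) (lift i k) =
  is_descent s k && (i != k.+1 :> nat).
Proof.
have [ik|ik] /= := eqVneq (i : nat) k.+1.
  rewrite andbF (@is_descentP _ _ _ i); last by rewrite /= /bump ik ltnn.
  by rewrite lift_perm_id lift_perm_lift lift_max ltnNge ltnW.
have bumpS : bump i k.+1 = (bump i k).+1.
  by rewrite /bump [in LHS]leq_eqVlt (negPf ik) ltnS addnS.
rewrite andbT; have [lt_kn|le_nk] := ltnP k.+1 n.
  rewrite (@is_descentP _ _ _ (lift i (Ordinal lt_kn))) //.
  rewrite !lift_perm_lift (@is_descentP _ _ _ (Ordinal lt_kn)) //.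
  by rewrite !lift_max.
apply/idP/idP => /is_descent_ltn; last by rewrite ltnNge le_nk.
rewrite ltnS /= /bump; case: (leqP i k) => [_|lt_ki].
  by rewrite add1n ltnNge le_nk.
by case/eqP: ik; apply/eqP; rewrite eqn_leq lt_ki (leq_trans _ le_nk) // -ltnS.
Qed.

(** The step down from the inserted letter is a new descent, unless that letter
    comes last. *)
Lemma descents_lift n (s : 'S_n) (i : 'I_n.+1) :
  descents (lift_perm i ord_max s) =
  ((i < n) + \sum_(k < n) (is_descent s k && (i != k.+1 :> nat)))%N.
Proof.
rewrite descentsE (bigD1_ord i) //=; congr addn.
  congr nat_of_bool; have [lt_in|le_ni] := ltnP i n.
    rewrite (@is_descentP _ _ _ (lift i (Ordinal lt_in))); last first.
      by rewrite /= /bump leqnn.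
    by rewrite lift_perm_id lift_perm_lift lift_max ltn_ord.
  by apply/negbTE/negP => /is_descent_ltn; rewrite ltnS ltnNge le_ni.
by apply: eq_bigr => k _; rewrite is_descent_lift.
Qed.

(** The positions where inserting the largest letter leaves the number of
    descents unchanged: the end of the word, and the middle of a descent. *)
Definition neutral_slots n (s : 'S_n) : {set 'I_n.+1} :=
  ord_max |: [set lift ord0 k | k in [set k | is_descent s k]].

Lemma card_neutral_slots n (s : 'S_n) : #|neutral_slots s| = (descents s).+1.
Proof.
rewrite cardsU1 card_imset; last exact: lift_inj.
case: imsetP => // -[k]; rewrite inE => /is_descent_ltn lt_kn /(congr1 val) /=.
by move/eqP; rewrite gtn_eqF.
Qed.

Lemma descents_insert_max n (s : 'S_n) (i : 'I_n.+1) :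
  descents (lift_perm i ord_max s) =
  (descents s + (i \notin neutral_slots s))%N.
Proof.
rewrite descents_lift [descents s]descentsE !inE.
case: imsetP => [[k]|not_slot] /=.
  rewrite inE orbT addn0 => s_k ->; rewrite (is_descent_ltn s_k).
  rewrite [RHS](bigD1 k) //= s_k [X in (_ + X)%N](bigD1 k) //= eqxx andbF add0n.
  by congr addn; apply: eq_bigr => l lk; rewrite eqSS eq_sym lk andbT.
rewrite orbF addnC; congr addn; last first.
  by rewrite -val_eqE /= ltn_neqAle -ltnS (ltn_ord i) andbT.
apply: eq_bigr => k _; case s_k: (is_descent s k) => //=.
case: eqP => // ik; case: not_slot; exists k; first by rewrite !inE.
exact: val_inj.
Qed.

(** The recurrence of the Eulerian numbers, in the form of a summation rule: of
    the n.+1 insertions into a permutation with d descents, d + 1 keep d and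
    n - d create one more. *)
Lemma sum_descents_insert_max (V : nmodType) n (F : nat -> V) :
  \sum_(t : 'S_n.+1) F (descents t) =
  \sum_(s : 'S_n)
     (F (descents s) *+ (descents s).+1 +
      F (descents s).+1 *+ (n - descents s)).
Proof.
rewrite big_lift_perm_max; apply: eq_bigr => s _.
rewrite (bigID [in neutral_slots s]) /=; congr (_ + _).
  rewrite -card_neutral_slots -sumr_const; apply: eq_bigr => i i_s.
  by rewrite descents_insert_max i_s addn0.
have -> : (n - descents s = #|~: neutral_slots s|)%N.
  by rewrite [RHS]cardsCs setCK card_ord card_neutral_slots subSS.
rewrite -sumr_const.
apply: eq_big => [i|i i_s]; first by rewrite !inE.
by rewrite descents_insert_max i_s addn1.
Qed.

(** * Waves of descents and derivatives of the cotangent *)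

Lemma is_derive_big_sum (R : numFieldType) (V W : normedModType R)
    (I : finType) (F : I -> V -> W) (dF : I -> W) (x v : V) :
  (forall i, is_derive x v (F i) (dF i)) ->
  is_derive x v (fun y => \sum_i F i y) (\sum_i dF i).
Proof.
move=> dFx; elim: (index_enum I) => [|i r IHr].
  rewrite big_nil (_ : (fun _ => _) = cst 0) //; first exact: is_derive_cst.
  by apply/funext => y; rewrite big_nil.
rewrite big_cons (_ : (fun _ => _) = F i + fun y => \sum_(j <- r) F j y).
  exact: is_deriveD.
by apply/funext => y; rewrite big_cons.
Qed.

Section Wave.
Variable R : realType.
Implicit Types (n : nat) (phi t : R).

Definition centered_descents n (s : 'S_n) : R :=
  2 * (descents s)%:R - n%:R + 1.

(** The real part of exp(i (phi - (n - 1) t)) A_n(exp(2 i t)), where A_n is the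
    generating polynomial of descents. Centring the exponents turns the
    recurrence below into a rule of differentiation, and a free phase gives
    access to all the real parts needed for a Fourier inversion. *)
Definition descent_wave n phi t : R :=
  \sum_(s : 'S_n) cos (centered_descents s * t + phi).

Lemma is_derive_descent_wave n phi t :
  is_derive t 1 (descent_wave n phi)
    (- \sum_(s : 'S_n)
         centered_descents s * sin (centered_descents s * t + phi)).
Proof.
rewrite -sumrN; apply: is_derive_big_sum => s.
by apply: is_derive_eq; rewrite /GRing.scale /=; ring.
Qed.

(** The sum multiplied by sin t is the opposite of the derivative of the wave, so
    that this is W_{n+1} = (n + 1) cos t W_n - sin t W_n'. It follows from the
    insertion rule, since (d + 1) cos(a - t) + (n - d) cos(a + t) equals
    (n + 1) cos t cos a + (2 d - n + 1) sin t sin a. *)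
Lemma descent_wave_rec n phi t :
  descent_wave n.+1 phi t = n.+1%:R * cos t * descent_wave n phi t
    + sin t * \sum_(s : 'S_n)
         centered_descents s * sin (centered_descents s * t + phi).
Proof.
rewrite /descent_wave.
rewrite (sum_descents_insert_max n
  (fun d => cos ((2 * d%:R - n.+1%:R + 1) * t + phi))).
rewrite !mulr_sumr -big_split /=; apply: eq_bigr => s _.
rewrite /centered_descents.
rewrite -[_ *+ (descents s).+1]mulr_natr -[_ *+ (n - _)]mulr_natr natrB;
  last first.
  case: n s => [|n] s; last exact/ltnW/descents_ltn.
  by rewrite descentsE big_ord0.
set d := (descents s)%:R; set a := (2 * d - n%:R + 1) * t + phi.
have -> : (2 * d - n.+1%:R + 1) * t + phi = a - t.
  by rewrite /a -[n.+1%:R]natr1; ring.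
have -> : (2 * (descents s).+1%:R - n.+1%:R + 1) * t + phi = a + t.
  by rewrite /a -!natr1 -/d; ring.
by rewrite cosB (cosD a) -[n.+1%:R]natr1 -[(descents s).+1%:R]natr1 -/d; ring.
Qed.

Lemma descent_wave1 phi t : descent_wave 1 phi t = cos phi.
Proof.
rewrite /descent_wave (big_pred1 1%g) => [|s]; last first.
  by apply/esym/eqP/permP => i; rewrite !ord1.
have -> : centered_descents (1%g : 'S_1) = 0.
  have := descents_ltn (1%g : 'S_1); rewrite ltnS leqn0 => /eqP.
  rewrite /centered_descents => ->; by rewrite mulr0 add0r addNr.
by rewrite mul0r add0r.
Qed.

Lemma descent_wave_le n phi t : `|descent_wave n phi t| <= n`!%:R.
Proof.
apply: (le_trans (ler_norm_sum _ _ _)).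
rewrite -card_Sn -sum1_card natr_sum; apply: ler_sum => s _; exact: cos_max.
Qed.

(** For n >= 1 this is cos phi times (-1)^n times the n-th derivative of the
    cotangent. *)
Definition cot_wave n phi t : R := descent_wave n phi t / sin t ^+ n.+1.

Lemma is_derive_cot_wave n phi t : sin t != 0 ->
  is_derive t 1 (cot_wave n phi) (- cot_wave n.+1 phi t).
Proof.
move=> s0; have sX0 : (sin ^+ n.+1) t != 0 by rewrite exprfctE expf_neq0.
have dw := is_derive_descent_wave n phi t.
have ds := is_deriveV (f := sin ^+ n.+1) sX0
  (is_deriveX n.+1 (is_derive_sin t)).
rewrite (_ : cot_wave n phi =
             descent_wave n phi * fun y => ((sin ^+ n.+1) y)^-1).
  apply: (is_derive_eq (is_deriveM dw ds)).
  rewrite /cot_wave descent_wave_rec /GRing.scale /= !exprfctE.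
  set w := descent_wave n phi t; set z := \sum_s _.
  by rewrite !exprS; field; rewrite s0 expf_neq0.
by apply/funext => y; rewrite /cot_wave fctE exprfctE.
Qed.

End Wave.

(** * Inequalities for sine and cosine *)

Local Open Scope classical_set_scope.
Local Open Scope ring_scope.

Section Sinc.
Variable R : realType.
Implicit Types x y a t : R.

Lemma sin_MVT a t : a < t ->
  exists2 c, a < c < t & sin t - sin a = cos c * (t - a).
Proof.
move=> lt_at.
have [|c] := @MVT R sin cos a t lt_at (fun x _ => is_derive_sin x).
  exact/continuous_subspaceT/continuous_sin.
by rewrite in_itv /=; exists c.
Qed.

Lemma ler_cos_pi x y : 0 <= x -> x <= y -> y <= pi -> cos y <= cos x :> R.
Proof.
move=> x0; rewrite le_eqVlt => /predU1P[-> //|xy] ypi.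
by rewrite ltW // ltr_cos // in_itv /=; lra.
Qed.

Lemma ler_sin_pi x y : 0 <= x -> x <= y -> y <= pi - x -> sin x <= sin y.
Proof.
move=> x0 xy yx; rewrite -!cosBpihalf -cos_norm -[leRHS]cos_norm.
by apply: ler_cos_pi => //; rewrite ?ler_norml ?[`|x - _|]ler0_norm; lra.
Qed.

Lemma mulr_cos_le_sin x : 0 <= x <= pi -> x * cos x <= sin x.
Proof.
case/andP; rewrite le_eqVlt => /predU1P[<- _|x0 xpi].
  by rewrite mul0r sin0.
have [c /andP[c0 cx]] := sin_MVT x0.
rewrite sin0 !subr0 => ->; rewrite mulrC ler_pM2r //.
by apply: ler_cos_pi => //; exact: ltW.
Qed.

(** The chords of the sine over [0, a] and [a, t] have slopes cos c >= cos d for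
    some c < a < d, since the cosine decreases on [0, pi]. *)
Lemma sinc_nincr a t : 0 < a -> a <= t -> t <= pi -> sin t / t <= sin a / a.
Proof.
move=> a0; rewrite le_eqVlt => /predU1P[-> //|lt_at] tpi.
have t0 := lt_trans a0 lt_at.
rewrite ler_pdivrMr // mulrAC ler_pdivlMr //.
have [c /andP[c0 ca]] := sin_MVT a0; rewrite sin0 !subr0 => sin_a.
have [d /andP[ad dt]] := sin_MVT lt_at; move/(canRL (subrK _)) => ->.
have cos_dc : cos d <= cos c by apply: ler_cos_pi; lra.
have := ler_wpM2r (ltW (mulr_gt0 a0 (eqbRL (subr_gt0 _ _) lt_at))) cos_dc.
by rewrite sin_a; nra.
Qed.

Lemma sin_halves x : sin x = 2 * (cos (x / 2) * sin (x / 2)).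
Proof. by rewrite mulr_natl -sin_mulr2n; congr sin; field. Qed.

(** The function cos y exp(y^2 / 2) starts at 1 and its derivative has the sign
    of y cos y - sin y. *)
Lemma cos_le_expR x : 0 <= x <= pi -> cos x <= expR (- (x ^+ 2 / 2)).
Proof.
case/andP; rewrite le_eqVlt => /predU1P[<- _|x0 xpi].
  by rewrite cos0 expr0n /= mul0r oppr0 expR0.
pose f y : R := cos y * expR (y ^+ 2 / 2).
have df y : is_derive y 1 f ((y * cos y - sin y) * expR (y ^+ 2 / 2)).
  have d2 : is_derive y 1 (fun z : R => z ^+ 2 / 2) y.
    by apply: is_derive_eq; rewrite /GRing.scale /=; field.
  have de := is_derive1_comp (f := expR) (is_derive_expR _) d2.
  by apply: (is_derive_eq (is_deriveM (is_derive_cos y) de));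
     rewrite /GRing.scale /=; ring.
have [|c] := @MVT R f _ 0 x x0 (fun y _ => df y).
  by apply: derivable_within_continuous => y _; case: (df y).
rewrite in_itv /= => /andP[c0 cx] fx.
rewrite expRN -[leRHS]mul1r.
have fx1 : f x <= 1.
  rewrite -[leRHS](_ : f 0 = 1); last first.
    by rewrite /f cos0 expr0n /= mul0r expR0 mulr1.
  rewrite -subr_le0 fx subr0; apply: mulr_le0_ge0 (ltW x0).
  apply: mulr_le0_ge0 (expR_ge0 _); rewrite subr_le0.
  by apply: mulr_cos_le_sin; lra.
by rewrite ler_pdivlMr ?expR_gt0.
Qed.

Lemma cvg_cos_halving x : cos (x / 2 ^+ p) @[p --> \oo] --> (1 : R).
Proof.
rewrite -[X in _ --> X]cos0; apply: cvg_comp; last exact: continuous_cos.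
rewrite (_ : (fun _ => _) = geometric x 2^-1).
  by apply: cvg_geometric; rewrite ger0_norm; lra.
by apply/funext => p; rewrite /geometric /= exprVn.
Qed.
End Sinc.

(** * Decay of the waves by iterated duplication *)

Section Bound.
Variables (R : realType) (phi : R).
Implicit Types t : R.

(** The duplication formula 2 cot t = cot (t / 2) + cot ((t + pi) / 2),
    differentiated n + 1 times. The induction starts from its first derivative,
    1 / sin(t/2)^2 + 1 / cos(t/2)^2 = 4 / sin(t)^2, where the phase is already
    a mere factor. *)
Lemma cot_wave_halving n t : 0 < t < pi ->
  cot_wave n.+1 phi (t / 2) + cot_wave n.+1 phi ((t + pi) / 2) =
  2 ^+ n.+2 * cot_wave n.+1 phi t.
Proof.
elim: n t => [|n IHn] t /andP[t0 tpi].
  rewrite /cot_wave !descent_wave1 mulrDl sinDpihalf.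
  rewrite (sin_halves t).
  have s0 : sin (t / 2) != 0 by rewrite gt_eqF // sin_gt0_pi //; lra.
  have c0 : cos (t / 2) != 0 by rewrite gt_eqF // cos_gt0_pihalf //; lra.
  rewrite !exprMn.
  have := cos2Dsin2 (t / 2).
  set c := cos _; set s := sin _ => cs1.
  transitivity (cos phi * (c ^+ 2 + s ^+ 2) / (s * c) ^+ 2).
    by field; rewrite s0 c0.
  by rewrite cs1; field; rewrite s0 c0.
have sin_neq0 x : 0 < x < pi -> sin x != 0 :> R.
  by move=> /sin_gt0_pi/lt0r_neq0.
have dL : is_derive t 1
    (fun x => cot_wave n.+1 phi (x / 2) + cot_wave n.+1 phi ((x + pi) / 2))
    (- 2^-1 * (cot_wave n.+2 phi (t / 2) + cot_wave n.+2 phi ((t + pi) / 2))).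
  have d1 : is_derive t 1 (fun x : R => x / 2) (2^-1).
    by apply: is_derive_eq; rewrite /GRing.scale /=; ring.
  have d2 : is_derive t 1 (fun x : R => (x + pi) / 2) (2^-1).
    by apply: is_derive_eq; rewrite /GRing.scale /=; ring.
  have e1 : is_derive (t / 2) 1 (cot_wave n.+1 phi)
      (- cot_wave n.+2 phi (t / 2)).
    by apply: is_derive_cot_wave; apply: sin_neq0; lra.
  have e2 : is_derive ((t + pi) / 2) 1 (cot_wave n.+1 phi)
      (- cot_wave n.+2 phi ((t + pi) / 2)).
    by apply: is_derive_cot_wave; apply: sin_neq0; lra.
  have e12 := is_deriveD (is_derive1_comp (g := fun x : R => x / 2) e1 d1)
    (is_derive1_comp (g := fun x : R => (x + pi) / 2) e2 d2).
  by apply: (is_derive_eq e12); ring.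
have dR : is_derive t 1 (fun x => 2 ^+ n.+2 * cot_wave n.+1 phi x)
    (- (2 ^+ n.+2 * cot_wave n.+2 phi t)).
  have e : is_derive t 1 (cot_wave n.+1 phi) (- cot_wave n.+2 phi t).
    by apply: is_derive_cot_wave; rewrite sin_neq0 ?t0.
  by apply: (is_derive_eq (is_deriveZ _ e)); rewrite /GRing.scale /=; ring.
have eq_near : \near t,
    cot_wave n.+1 phi (t / 2) + cot_wave n.+1 phi ((t + pi) / 2) =
    2 ^+ n.+2 * cot_wave n.+1 phi t.
  near=> x; apply: IHn.
  suff : x \in `]0, pi[ by rewrite in_itv.
  by near: x; apply: near_in_itvoo; rewrite in_itv /= t0.
have [_ eqL] := near_eq_is_derive eq_near dL.
case: dR => _; rewrite eqL mulNr => /oppr_inj eqLR.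
by rewrite exprS -mulrA -eqLR; field.
Unshelve. all: by end_near.
Qed.

(** For p = 0 this is the trivial bound of the wave by the number of its terms,
    combined with sin a <= sin t. Halving maps t to the points t / 2 and
    (t + pi) / 2, both at distance at least a / 2 from 0 and pi; the bounds at
    these points share the factor (2 ^ p sin (a / 2 ^ p.+1)) ^- n, and their
    weights 1 / sin(t/2)^2 and 1 / cos(t/2)^2 add up to 4 / sin(t)^2. *)
Lemma cot_wave_le_halving p n t a :
  0 < t < pi -> 0 < a -> a <= t -> a <= pi - t ->
  `|cot_wave n.+1 phi t| * (sin t ^+ 2 * (2 ^+ p * sin (a / 2 ^+ p)) ^+ n) <=
     (n.+1)`!%:R.
Proof.
elim: p t a => [|p IHp] t a t0pi a0 at1 at2.
  have st0 := sin_gt0_pi t0pi.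
  have sa0 : 0 < sin a by rewrite sin_gt0_pi //; lra.
  have le_sa : sin a <= sin t by apply: ler_sin_pi; lra.
  rewrite expr0 mul1r divr1.
  apply: le_trans (descent_wave_le n.+1 phi t).
  rewrite /cot_wave normrM normfV (ger0_norm (exprn_ge0 _ (ltW st0))).
  rewrite -mulrA ler_piMr // ler_pdivrMl ?exprn_gt0 // mulr1.
  rewrite -[n.+2]addn2 exprD mulrC ler_wpM2r ?sqr_ge0 //.
  by apply: lerXn2r => //; rewrite nnegrE ltW.
have [st0 ct0] : 0 < sin (t / 2) /\ 0 < cos (t / 2).
  by split; [rewrite sin_gt0_pi //|rewrite cos_gt0_pihalf //]; lra.
have w1_le := IHp (t / 2) (a / 2) ltac:(lra) ltac:(lra) ltac:(lra) ltac:(lra).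
have := IHp ((t + pi) / 2) (a / 2) ltac:(lra) ltac:(lra) ltac:(lra) ltac:(lra).
have -> : sin ((t + pi) / 2) = cos (t / 2) by rewrite mulrDl sinDpihalf.
have eq_a : a / 2 / 2 ^+ p = a / 2 ^+ p.+1 by rewrite exprS invfM mulrA.
move: w1_le; rewrite eq_a.
have eq_w := cot_wave_halving n t0pi.
rewrite (sin_halves t).
have cs1 := cos2Dsin2 (t / 2).
have sa0 : 0 <= sin (a / 2 ^+ p.+1).
  rewrite sin_ge0_pi // divr_ge0 ?exprn_ge0 ?(ltW a0) //=.
  rewrite ler_pdivrMr ?exprn_gt0 // (le_trans (y := pi)) //; first by lra.
  by rewrite ler_peMr ?pi_ge0 // exprn_ege1 //; lra.
set sx := sin (a / _) in sa0 *.
rewrite [2 ^+ p.+1]exprS -[2 * _ * sx]mulrA [(2 * _) ^+ n]exprMn.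
have : 0 <= (2 ^+ p * sx) ^+ n by rewrite exprn_ge0 ?mulr_ge0 ?exprn_ge0.
move: ((2 ^+ p * sx) ^+ n) => B B0 le1 le2.
have norm_w : 2 ^+ n.+2 * `|cot_wave n.+1 phi t| <=
    `|cot_wave n.+1 phi (t / 2)| + `|cot_wave n.+1 phi ((t + pi) / 2)|.
  by rewrite -(ger0_norm (exprn_ge0 n.+2 (ler0n R 2))) -normrM -eq_w ler_normD.
move: norm_w cs1 st0 ct0 le1 le2.
set w : R := `|cot_wave n.+1 phi t|.
set w1 : R := `|cot_wave n.+1 phi (t / 2)|.
set w2 : R := `|cot_wave n.+1 phi ((t + pi) / 2)|.
set s := sin _; set c := cos _; set F : R := _`!%:R.
move=> norm_w cs1 s0 c0 le1 le2.
have cs0 : 0 <= c ^+ 2 * s ^+ 2 * B by rewrite mulr_ge0 // mulr_ge0 ?sqr_ge0.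
have -> : w * ((2 * (c * s)) ^+ 2 * (2 ^+ n * B)) =
    (2 ^+ n.+2 * w) * (c ^+ 2 * s ^+ 2 * B)
  by rewrite (exprD 2 2 n : 2 ^+ n.+2 = _); ring.
apply: (le_trans (ler_wpM2r cs0 norm_w)).
have -> : (w1 + w2) * (c ^+ 2 * s ^+ 2 * B) =
    c ^+ 2 * (w1 * (s ^+ 2 * B)) + s ^+ 2 * (w2 * (c ^+ 2 * B)) by ring.
have -> : F = c ^+ 2 * F + s ^+ 2 * F by rewrite -mulrDl cs1 mul1r.
by rewrite lerD // ler_wpM2l // sqr_ge0.
Qed.

(** The limit of the previous bounds, as 2 ^ p sin (a / 2 ^ p) is at least
    a cos (a / 2 ^ p), which tends to a. *)
Lemma cot_wave_le n t a : 0 < t < pi -> 0 < a -> a <= t -> a <= pi - t ->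
  `|cot_wave n.+1 phi t| * (sin t ^+ 2 * a ^+ n) <= (n.+1)`!%:R.
Proof.
move=> t0pi a0 at1 at2.
have w_ge0 : 0 <= `|cot_wave n.+1 phi t| * sin t ^+ 2.
  by rewrite mulr_ge0 ?sqr_ge0.
have cvg_a : `|cot_wave n.+1 phi t| * (sin t ^+ 2 * (a * cos (a / 2 ^+ p)) ^+ n)
    @[p --> \oo] --> `|cot_wave n.+1 phi t| * (sin t ^+ 2 * (a * 1) ^+ n).
  have cvg_c := cvgMl_tmp (a := a) (@cvg_cos_halving R a).
  do 2 apply: cvgMl_tmp.
  exact: (cvg_comp _ _ (cvg_c _) (@exprn_continuous R n (a * 1))).
rewrite -[a in leLHS]mulr1.
apply: (cvgr_to_le cvg_a); near=> p.
apply: le_trans (cot_wave_le_halving p n t0pi a0 at1 at2).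
rewrite [leLHS]mulrA [leRHS]mulrA (ler_wpM2l w_ge0) //.
have q0 : 0 < 2 ^+ p :> R by rewrite exprn_gt0.
have q_ge1 : 1 <= 2 ^+ p :> R by rewrite exprn_ege1 //; lra.
set x := a / 2 ^+ p.
have ax : a = 2 ^+ p * x by rewrite /x mulrC divfK ?gt_eqF.
have x0 : 0 < x by rewrite divr_gt0.
have xa : x <= a by rewrite ler_pdivrMr // ler_peMr // ltW.
have cx0 : 0 <= cos x by apply: cos_ge0_pihalf; lra.
have le_x : a * cos x <= 2 ^+ p * sin x.
  by rewrite {1}ax -mulrA (ler_wpM2l (ltW q0)) // mulr_cos_le_sin //; lra.
by apply: lerXn2r => //; rewrite nnegrE ?(le_trans _ le_x) ?mulr_ge0 // ltW.
Unshelve. all: by end_near.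
Qed.

End Bound.

(** * Residues of the number of descents *)

Section Main.
Variable R : realType.
Implicit Types (phi t x : R) (n b k : nat).

(** Multiplying the bound on the cotangent wave by sin(t)^(n + 2) gives the factor
    (sin a / a) ^ n, where a is the distance from t to {0, pi} and
    sin t = sin a; x is any lower bound for that distance. *)
Lemma descent_wave_le_sinc n phi t x : 0 < x -> x <= t -> t <= pi - x ->
  `|descent_wave n.+1 phi t| <= (n.+1)`!%:R * (sin x / x) ^+ n.
Proof.
move=> x0 xt tx; have t0pi : 0 < t < pi by lra.
have s0 : 0 < sin t by exact: sin_gt0_pi.
pose a := Order.min t (pi - t).
have a0 : 0 < a by rewrite /a lt_min; lra.
have [at1 at2] : a <= t /\ a <= pi - t by split; rewrite /a ge_min lexx ?orbT.
have sin_a : sin t = sin a.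
  by rewrite /a; case: leP => _ //; rewrite sinB sinpi cospi; ring.
have xa : x <= a by rewrite /a le_min; lra.
have le_w := @cot_wave_le R phi n t a t0pi a0 at1 at2.
have -> : `|descent_wave n.+1 phi t| =
    `|cot_wave n.+1 phi t| * (sin t ^+ 2 * a ^+ n) * (sin a / a) ^+ n.
  rewrite /cot_wave normrM normfV.
  rewrite [`|sin t ^+ _|]ger0_norm ?exprn_ge0 ?(ltW s0) //.
  rewrite -sin_a expr_div_n (exprD _ 2 n : sin t ^+ n.+2 = _).
  by field; rewrite !expf_neq0 ?gt_eqF.
have sinc0 : 0 <= sin a / a by rewrite -sin_a divr_ge0 // ltW.
apply: ler_pM => //; first by rewrite !mulr_ge0 ?exprn_ge0 // ltW.
  by rewrite exprn_ge0.
have le_sinc : sin a / a <= sin x / x by apply: sinc_nincr => //; lra.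
by apply: lerXn2r => //; rewrite nnegrE (le_trans sinc0).
Qed.

Lemma rhoE b : rho R b = sin (pi / b%:R) / (pi / b%:R).
Proof. by rewrite /rho invf_div mulrA [sin _ * _]mulrC. Qed.

Lemma rho_gt0 b : (2 <= b)%N -> 0 < rho R b.
Proof.
move=> b2.
have b2R : 2 <= b%:R :> R by rewrite ler_nat.
have pi0 := @pi_gt0 R.
have x0 : 0 < pi / b%:R :> R by rewrite divr_gt0 //; lra.
rewrite rhoE divr_gt0 // sin_gt0_pi // x0 ltr_pdivrMr ?ltr_pMr; lra.
Qed.

(** With x = pi / b, the quotient sin x / x is cos (x / 2) times
    sin (x / 2) / (x / 2), hence at most cos (x / 2), which is at most
    exp(- x^2 / 8). *)
Lemma rho_le_expR b : (2 <= b)%N ->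
  rho R b <= expR (- (pi ^+ 2 / (8 * b%:R ^+ 2))).
Proof.
move=> b2.
have b2R : 2 <= b%:R :> R by rewrite ler_nat.
have pi0 := @pi_gt0 R.
have b0 : b%:R != 0 :> R by rewrite gt_eqF //; lra.
rewrite rhoE; set x := pi / b%:R.
have x0 : 0 < x by rewrite divr_gt0 //; lra.
have xpi : x <= pi / 2 by rewrite ler_pM2l // lef_pV2 // posrE; lra.
apply: (@le_trans _ _ (cos (x / 2))).
  rewrite ler_pdivrMr // sin_halves mulrCA ler_wpM2l //.
    by apply: cos_ge0_pihalf; lra.
  have x20 : 0 < x / 2 by lra.
  have [c _] := sin_MVT x20; rewrite sin0 !subr0 => ->.
  have := ler_wpM2r (ltW x20) (cos_le1 c); lra.
have -> : pi ^+ 2 / (8 * b%:R ^+ 2) = (x / 2) ^+ 2 / 2 by rewrite /x; field.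
by apply: cos_le_expR; lra.
Qed.

(** Orthogonality of the characters of Z/b. When b does not divide m, multiplying
    by 2 sin(pi m / b), which is not 0, makes the sum telescope to 0. *)
Lemma sum_cos_multiples b m : (0 < b)%N ->
  \sum_(j < b) cos (2 * (pi * j%:R / b%:R) * m%:R) =
  (if (b %| m)%N then b%:R else 0) :> R.
Proof.
move=> b0.
have bR0 : b%:R != 0 :> R by rewrite pnatr_eq0 -lt0n.
case: ifP => [/dvdnP[q ->]|/negbT ndvd_bm].
  rewrite -[X in _ = X%:R]card_ord -sumr_const; apply: eq_bigr => j _.
  rewrite (_ : _ * _ = 0 + pi *+ 2 *+ (j * q)).
    by rewrite (periodicn (@cosD2pi R)) cos0.
  by rewrite -[_ *+ (j * q)]mulr_natr !natrM; field.
pose al : R := pi * m%:R / b%:R.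
pose f j : R := sin ((2 * j%:R - 1) * al).
have sin_al : sin al != 0.
  rewrite /al {1}(divn_eq m b).
  rewrite (_ : _ / _ = pi * (m %% b)%:R / b%:R + pi *+ (m %/ b)); last first.
    by rewrite natrD natrM -[_ *+ (m %/ b)]mulr_natr; field.
  rewrite (alternatingn (@sinDpi R)) mulf_eq0 signr_eq0 /=.
  rewrite gt_eqF // sin_gt0_pi //.
  have r0 : (0 < m %% b)%N by rewrite lt0n.
  rewrite divr_gt0 ?mulr_gt0 ?pi_gt0 ?ltr0n //=.
  by rewrite ltr_pdivrMr ?ltr0n // ltr_pM2l ?pi_gt0 // ltr_nat ltn_pmod.
apply: (mulfI (mulf_neq0 (lt0r_neq0 (ltr0Sn R 1)) sin_al)); rewrite mulr0.
rewrite mulr_sumr (eq_bigr (fun j : 'I_b => f j.+1 - f j)).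
  rewrite -(big_mkord predT (fun j => f j.+1 - f j)) telescope_sumr // /f.
  rewrite (_ : (2 * b%:R - 1) * al = (2 * 0 - 1) * al + pi *+ 2 *+ m).
    by rewrite (periodicn (@sinD2pi R)) subrr.
  by rewrite -[_ *+ m]mulr_natr /al; field.
move=> j _; rewrite /f.
have -> : (2 * j.+1%:R - 1) * al = 2 * (j%:R * al) + al.
  by rewrite -natr1; ring.
have -> : (2 * j%:R - 1) * al = 2 * (j%:R * al) - al by ring.
have -> : 2 * (pi * j%:R / b%:R) * m%:R = 2 * (j%:R * al) by rewrite /al; field.
by rewrite sinD sinB; ring.
Qed.

Lemma sum_eulerian n (P : pred nat) :
  \sum_(0 <= r < n.+1 | P r) (eulerian n.+1 r)%:R =
  \sum_(s : 'S_n.+1) (P (descents s))%:R :> R.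
Proof.
have eulerianE r :
    (eulerian n.+1 r)%:R = \sum_(s : 'S_n.+1) (descents s == r)%:R :> R.
  rewrite /eulerian -sum1_card natr_sum big_mkcond; apply: eq_bigr => s _.
  by rewrite inE; case: (_ == _).
rewrite (eq_bigr _ (fun r _ => eulerianE r)) exchange_big.
apply: eq_bigr => s _.
rewrite big_mkord big_mkcond (bigD1 (Ordinal (descents_ltn s))) //= big1 ?addr0.
  by rewrite eqxx; case: (P _).
move=> r; rewrite -val_eqE /= eq_sym => /negPf ->.
by rewrite if_same.
Qed.

(** Fourier inversion on Z/b. The phase cancels the centring of the wave and
    shifts descents by b - k, which represents - k modulo b. *)
Lemma sum_eulerian_mod n b k : (0 < b)%N -> (k < b)%N ->
  b%:R * \sum_(0 <= r < n.+1 | (r == k %[mod b])%N) (eulerian n.+1 r)%:R =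
  \sum_(j < b) descent_wave n.+1
     ((n%:R + 2 * (b - k)%:R) * (pi * j%:R / b%:R)) (pi * j%:R / b%:R) :> R.
Proof.
move=> b0 kb; rewrite sum_eulerian mulr_sumr exchange_big /=.
apply: eq_bigr => s _; have kd : (k <= descents s + b)%N.
  by rewrite (leq_trans (ltnW kb)) ?leq_addl.
rewrite -[X in nat_of_bool (X == _)]modnDr eqn_mod_dvd //.
transitivity (if (b %| descents s + b - k)%N then b%:R else 0 : R).
  by case: ifP; rewrite ?mulr1 ?mulr0.
rewrite -sum_cos_multiples //; apply: eq_bigr => j _; congr cos.
rewrite /centered_descents -addnBA ?natrD; last exact: ltnW.
by rewrite -natr1; ring.
Qed.

End Main.

Theorem corollary3p2 (R : realType) (n b k : nat)
    (hn : (1 <= n)%N) (hb : (2 <= b)%N) (hk : (k < b)%N) :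
  [/\ 0 < rho R b < 1,
      `| (n`!%:R)^-1 * \sum_(0 <= r < n | (r == k %[mod b])%N) (eulerian n r)%:R
         - b%:R^-1 | <= (b%:R - 1) / b%:R * rho R b ^+ (n - 1)
    & rho R b ^+ (n - 1) <=
        expR (- ((n%:R - 1) * pi ^+ 2 / (8 * b%:R ^+ 2)))].
Proof.
have b0 : (0 < b)%N := ltnW hb.
have bR0 : 0 < b%:R :> R by rewrite ltr0n.
case: n hn => // n _; rewrite subn1 /=.
have pi0 := @pi_gt0 R.
have e0 : 0 < pi ^+ 2 / (8 * b%:R ^+ 2) :> R.
  by rewrite divr_gt0 ?mulr_gt0 ?exprn_gt0.
have r0 := rho_gt0 R hb; have r_le := rho_le_expR R hb.
split.
- by rewrite r0 (le_lt_trans r_le) // expR_lt1 oppr_lt0.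
- have f0 : 0 < (n.+1)`!%:R :> R by rewrite ltr0n fact_gt0.
  set S := (X in _ * X - _).
  have -> : (n.+1)`!%:R^-1 * S - b%:R^-1 =
      (b%:R * S - (n.+1)`!%:R) / ((n.+1)`!%:R * b%:R).
    by field; rewrite !gt_eqF.
  rewrite normrM normfV [`|_ * b%:R|]gtr0_norm ?mulr_gt0 //.
  rewrite ler_pdivrMr ?mulr_gt0 //.
  rewrite /S sum_eulerian_mod //.
  case: b hb hk b0 bR0 e0 r0 r_le S => // b hb hk b0 bR0 e0 r0 r_le S.
  (* The frequency 0 counts all permutations. *)
  rewrite big_ord_recl /= mulr0 mul0r mulr0.
  have -> : descent_wave n.+1 0 0 = (n.+1)`!%:R :> R.
    rewrite /descent_wave -card_Sn -sum1_card natr_sum.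
    by apply: eq_bigr => s _; rewrite mulr0 addr0 cos0.
  rewrite (addrC (n.+1)`!%:R) addrK (le_trans (ler_norm_sum _ _ _)) //.
  have -> : (b.+1%:R - 1) / b.+1%:R * rho R b.+1 ^+ n * ((n.+1)`!%:R * b.+1%:R)
      = \sum_(j < b) (n.+1)`!%:R * rho R b.+1 ^+ n.
    rewrite sumr_const card_ord -[RHS]mulr_natr -natr1.
    by field; rewrite natr1 gt_eqF.
  (* For 0 < j < b, the point pi j / b is at distance at least pi / b from 0
     and pi. *)
  apply: ler_sum => j _; rewrite -[bump 0 j]/j.+1 rhoE.
  apply: descent_wave_le_sinc.
  - by rewrite divr_gt0.
  - by rewrite ler_pM2r ?invr_gt0 // ler_peMr ?(ltW pi0) // ler1n.
  - rewrite ler_pdivrMr // mulrBl divfK ?gt_eqF // -[X in _ - X]mulr1 -mulrBr.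
    by rewrite ler_pM2l // lerBrDr natr1 ler_nat ltnS ltn_ord.
- rewrite -natr1 addrK -mulrA -mulrN expRM_natl.
  by apply: lerXn2r; rewrite // nnegrE ?expR_ge0 // ltW.
Qed.
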